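(* Let $d\geq 1$, let $G$ be a $d$--regular bipartite graph on $v(G)=2n$ vertices, and let $m_k(G)$ denote the number of matchings of size $k$ in $G$. Let $0\leq p\leq 1$. Then $$\sum_{k=0}^n m_k(G)\left(\frac{p}{d}\left(1-\frac{p}{d}\right)\right)^{k}(1-p)^{2(n-k)}\geq \left(1-\frac{p}{d}\right)^{nd}.$$
   Context: A matching of size $k$ is a set of $k$ pairwise vertex-disjoint edges; $m_0(G)=1$. The convention $0^0=1$ is used. *)

(* Defs.v *)
From mathcomp Require Import all_boot all_order all_algebra.
Set Implicit Arguments. Unset Strict Implicit. Unset Printing Implicit Defensive.

Definition simple_graph (V : finType) (e : rel V) : Prop :=
  (forall x y, e x y = e y x) /\ (forall x, ~~ e x x).

Definition regular (V : finType) (e : rel V) (d : nat) : Prop :=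
  forall x : V, #|[set y | e x y]| = d.

Definition bipartite (V : finType) (e : rel V) : Prop :=
  exists c : V -> bool, forall x y, e x y -> c x != c y.

Definition is_edge (V : finType) (e : rel V) (E : {set V}) : bool :=
  [exists x, exists y, e x y && (E == [set x; y])].

Definition is_matching (V : finType) (e : rel V) (M : {set {set V}}) : bool :=
  [forall E in M, is_edge e E] &&
  [forall E1 in M, forall E2 in M, (E1 != E2) ==> [disjoint E1 & E2]].

Definition num_matchings (V : finType) (e : rel V) (k : nat) : nat :=
  #|[set M : {set {set V}} | is_matching e M && (#|M| == k)]|.

(* Main.v *)
(** Write q = 1 - p and t = (p/d)(1 - p/d). Index the two colour classes by i
    and j. The product over i of q + t * (sum of the x_j with j adjacent to i)
    is a polynomial f in the x_j, and applying g |-> q g(0) + g'(0) to f in each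
    variable in turn extracts exactly the sum over matchings. As in Gurvits's
    proof of Schrijver's theorem, each application costs a controlled factor.
    All intermediate polynomials are nonzero when every x_j lies in {Im > 0} or
    in [0, +oo), so each of them is real rooted with negative roots in each
    variable, hence bounded by a_0 (1 + a_1 x / (a_0 d))^d. By weighted AM-GM, f
    is at least (1 - p/d)^(n p) * (product of the x_j^p), and this form of bound
    survives each application up to a factor (1 - p/d)^(d - p).

    This needs real powers, so it gives the inequality over the real numbers.
    Both sides are polynomials in p with rational coefficients, and a rational
    polynomial that is nonnegative on the real interval [0, 1] is nonnegative on
    [0, 1] in every ordered field: dividing out X, 1 - X and the squares of
    minimal polynomials of interior roots leaves a polynomial bounded below by a
    positive rational. *)

Require Import Defs.
From mathcomp Require Import all_boot all_order all_algebra.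
From mathcomp Require Import complex polyrcf.
From mathcomp Require Import Rstruct reals topology normedtype sequences derive exp.
From mathcomp Require Import ring lra.
From mathcomp Require Import boolp.
Import Order.TTheory GRing.Theory Num.Theory numFieldNormedType.Exports.
Local Open Scope ring_scope.

Set Implicit Arguments.
Unset Strict Implicit.
Unset Printing Implicit Defensive.

(** * Transfer from the reals to arbitrary ordered fields *)

(** A single rational [L] bounds the values and is a Lipschitz constant in all ordered fields at
    once; this uniformity lets an estimate over the reals be reused in another field. It is built
    along Horner's scheme. *)
Lemma ratr_horner_bounds (s : {poly rat}) :
  exists2 L : rat, 0 <= L & forall (F : realFieldType) (x y : F),
    0 <= x <= 1 -> 0 <= y <= 1 ->
    `|(map_poly ratr s).[x]| <= ratr L /\
    `|(map_poly ratr s).[x] - (map_poly ratr s).[y]| <= ratr L * `|x - y|.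
Proof.
elim/poly_ind: s => [|s c [L L0 IH]].
  exists 0 => // F x y _ _; rewrite map_poly0 !horner0 subrr normr0 rmorph0.
  by rewrite mul0r.
exists (2 * L + `|c|); first by rewrite addr_ge0 ?mulr_ge0.
move=> F x y hx hy; rewrite rmorphD rmorphM /= map_polyX map_polyC /=.
rewrite !hornerMXaddC rmorphD rmorphM /= rmorph_nat ratr_norm.
have [bx dxy] := IH F x y hx hy; have [by_ _] := IH F y y hy hy.
set S := map_poly _ _ in bx dxy by_ *.
have L0' : 0 <= ratr L :> F by rewrite ler0q.
have hxn : `|x| <= 1 by rewrite ger0_norm; case/andP: hx.
have hSx : `|S.[x] * x| <= ratr L.
  by rewrite normrM; apply: le_trans (ler_pM _ _ bx hxn) _; rewrite ?normr_ge0 ?mulr1.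
have c0 : 0 <= `|ratr c| :> F by [].
split; first by apply: le_trans (ler_normD _ _) _; lra.
have -> : S.[x] * x + ratr c - (S.[y] * y + ratr c)
   = (S.[x] - S.[y]) * x + S.[y] * (x - y) by ring.
apply: le_trans (ler_normD _ _) _; rewrite (normrM (_ - _)) (normrM S.[y]).
have h1 : `|S.[x] - S.[y]| * `|x| <= ratr L * `|x - y|.
  by rewrite -[leRHS]mulr1 ler_pM.
have h2 : `|S.[y]| * `|x - y| <= ratr L * `|x - y| by rewrite ler_wpM2r.
have h3 : 0 <= `|ratr c| * `|x - y| by rewrite mulr_ge0.
rewrite mulrDl -mulrA; lra.
Qed.

(** Induction on the upper bound [N] stands in for a floor, which need not exist in a
    non-Archimedean field. *)
Lemma near_natr (F : realFieldType) (N : nat) (x : F) :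
  0 <= x <= N%:R -> exists2 k, (k <= N)%N & `|x - k%:R| <= 1.
Proof.
elim: N => [|N IH] /andP[x0 xN].
  by exists 0%N => //; rewrite (_ : x = 0) ?subrr ?normr0 //; apply/le_anti/andP.
have [le|lt] := leP x N%:R.
  by have [|k kN hk] := IH; [rewrite x0|exists k => //; exact: leqW].
exists N => //; rewrite ger0_norm ?subr_ge0 ?(ltW lt) // lerBlDr addrC.
by rewrite -natr1 in xN.
Qed.

(* [F] may be non-Archimedean: [p] is compared with a nearby multiple of [1/N],
   where the value of [q] exceeds a fixed positive rational. *)
Lemma ratr_horner_gt0 (K : realType) (q : {poly rat}) :
  (forall x : K, 0 <= x <= 1 -> 0 < (map_poly ratr q).[x]) ->
  forall (F : realFieldType) (p : F), 0 <= p <= 1 -> 0 < (map_poly ratr q).[p].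
Proof.
move=> qpos F p hp.
have [|c cI cmin] := @EVT_min K (horner (map_poly ratr q)) 0 1 ler01.
  by apply: continuous_subspaceT => x; exact: continuous_horner.
rewrite in_itv /= in cI.
have [e] := rat_in_itvoo (qpos c cI); rewrite in_itv /= ltr0q => /andP[e0 ec].
have [L L0 hL] := ratr_horner_bounds q.
(* The grid of step [1/N] is fine enough that [q] varies by less than [e] between [p] and a
   neighbouring grid point. *)
pose N := (Num.bound (L / e)).+1.
have N0 : 0 < N%:R :> rat by rewrite ltr0n.
have hN : L / N%:R < e.
  rewrite ltr_pdivrMr // mulrC -ltr_pdivrMr //.
  apply: lt_trans (archi_boundP _) _; first by rewrite divr_ge0 // ltW.
  by rewrite ltr_nat.
have NF0 : 0 < N%:R :> F by rewrite ltr0n.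
have [|k kN hk] := @near_natr F N (p * N%:R).
  by rewrite mulr_ge0 ?ler_piMl ?ler0n; case/andP: hp.
pose y := k%:R / N%:R : rat.
have hy (T : realFieldType) : 0 <= (ratr y : T) <= 1.
  by rewrite ler0q -(rmorph1 ratr) ler_rat divr_ge0 ?ler0n // ler_pdivrMr // mul1r ler_nat.
(* The grid point [y] is rational, so this inequality is proved in [K], from the minimum there, and
   then read in [F]. *)
have hq : e < q.[y].
  rewrite -(ltr_rat K); apply: lt_le_trans ec _.
  by rewrite -horner_map; apply: cmin; rewrite in_itv /= hy.
have [_ dpy] := hL F p (ratr y) hp (hy F).
have : ratr L * `|p - ratr y| <= ratr (L / N%:R).
  have -> : ratr (L / N%:R) = ratr L * N%:R^-1 :> F.
    by rewrite (rmorphM (ratr : rat -> F)) fmorphV rmorph_nat.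
  apply: ler_wpM2l; first by rewrite ler0q.
  have -> : p - ratr y = (p * N%:R - k%:R) / N%:R.
    have -> : ratr y = k%:R / N%:R :> F.
      by rewrite (rmorphM (ratr : rat -> F)) fmorphV !rmorph_nat.
    by rewrite mulrBl mulfK ?gt_eqF.
  rewrite normrM normfV (gtr0_norm NF0) ler_piMl // invr_ge0 ltW //.
move=> /(le_trans dpy); rewrite horner_map => h.
have := ltr_rat F (L / N%:R) e; rewrite hN => h2.
have := ltr_rat F e q.[y]; rewrite hq => h3.
move: h; rewrite ler_norml => /andP[h _]; lra.
Qed.

Lemma horner_ge0_factor (K : rcfType) (g q : {poly K}) : g != 0 ->
  (forall x, 0 <= x <= 1 -> 0 <= g.[x]) ->
  (forall x, 0 <= x <= 1 -> 0 <= (g * q).[x]) ->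
  forall x, 0 <= x <= 1 -> 0 <= q.[x].
Proof.
move=> g0 hg hgq x hx; rewrite leNgt; apply/negP => qx.
have [m [g1 g1x Dg]] := multiplicity_XsubC g x; rewrite g0 /= in g1x.
(* Positivity of this polynomial near [x] says both that [q] is negative and that the cofactor [g1]
   of [g] is nonzero; at [y != x] this makes [g * q] negative. *)
have f0 : 0 < (- q * g1 ^+ 2).[x].
  rewrite hornerM hornerN horner_exp mulr_gt0 ?oppr_gt0 // lt_neqAle sqr_ge0 eq_sym sqrf_eq0 andbT.
  exact: g1x.
have [e e0 he] := poly_cont x (- q * g1 ^+ 2) f0.
have near y : `|y - x| < e -> y != x -> 0 <= y <= 1 -> False.
  move=> /he h yx hy.
  have {h} fy : 0 < (- q * g1 ^+ 2).[y].
    by move: h; rewrite ltr_norml => /andP[h _]; lra.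
  have qy : q.[y] < 0.
    rewrite ltNge; apply/negP => qy; move: fy; rewrite hornerM hornerN horner_exp ltNge.
    by rewrite mulNr oppr_le0 mulr_ge0 // sqr_ge0.
  have gy : 0 < g.[y].
    rewrite lt_neqAle hg // andbT eq_sym Dg hornerM horner_exp hornerXsubC mulf_neq0 ?expf_neq0 ?subr_eq0 //.
    by apply/eqP => g10; move: fy; rewrite hornerM hornerN horner_exp g10 expr0n /= mulr0 ltxx.
  by have := hgq y hy; rewrite hornerM leNgt pmulr_rlt0 ?qy.
(* The nearby point must stay in the unit interval: it is taken to the right of [x], or to the left
   when [x] is 1. *)
have [x1|x1] := ltP x 1.
  pose t := Num.min (e / 2) ((1 - x) / 2).
  have t0 : 0 < t by rewrite lt_min; apply/andP; split; lra.
  have t1 : t <= e / 2 by rewrite ge_min lexx.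
  have t2 : t <= (1 - x) / 2 by rewrite ge_min lexx orbT.
  apply: (near (x + t)); [|by apply/eqP; lra|lra].
  by rewrite (_ : x + t - x = t) ?gtr0_norm //; [lra|ring].
pose t := Num.min (e / 2) (x / 2).
have t0 : 0 < t by rewrite lt_min; apply/andP; split; lra.
have t1 : t <= e / 2 by rewrite ge_min lexx.
have t2 : t <= x / 2 by rewrite ge_min lexx orbT.
apply: (near (x - t)); [|by apply/eqP; lra|lra].
by rewrite (_ : x - t - x = - t) ?normrN ?gtr0_norm //; [lra|ring].
Qed.

(** If [q] fails to divide some [h] vanishing at [r], the remainder of [h] by [q] also vanishes at
    [r] and has smaller size, so the descent ends. *)
Lemma ratr_minpoly (K : numFieldType) (r : K) (q : {poly rat}) :
  q != 0 -> root (map_poly ratr q) r ->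
  exists m : {poly rat}, [/\ m != 0, root (map_poly ratr m) r &
    forall h : {poly rat}, root (map_poly ratr h) r -> m %| h].
Proof.
elim: (size q) {-2}q (leqnn (size q)) => [|n IH] {}q sq q0 qr.
  by move: sq q0; rewrite leqn0 size_poly_eq0 => ->.
have [[h [hr hq]]|nh] :=
  pselect (exists h, root (map_poly ratr h) r /\ ~~ (q %| h)); last first.
  exists q; split=> // h hr; apply/negP => hq; apply: nh; exists h.
  by split => //; apply/negP.
apply: (IH (h %% q)) => //.
  by rewrite -ltnS (leq_trans _ sq) // ltn_modp.
move: hr; rewrite {1}(divp_eq h q) rmorphD rmorphM /= /root !hornerE.
by rewrite (eqP qr) mulr0 add0r.
Qed.

(** In characteristic 0 the derivative of [m] is nonzero and of smaller degree, so [m] cannot divide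
    it. *)
Lemma deriv_minpoly_neq0 (K : numFieldType) (r : K) (m : {poly rat}) :
  m != 0 -> root (map_poly ratr m) r ->
  (forall h : {poly rat}, root (map_poly ratr h) r -> m %| h) ->
  (map_poly ratr m)^`().[r] != 0.
Proof.
move=> m0 mr mmin; apply/negP => dr.
have sm : (1 < size m)%N.
  by rewrite -(size_map_poly (ratr : rat -> K)) (root_size_gt1 _ mr) ?map_poly_eq0.
have d0 : m^`() != 0.
  apply/negP => /eqP /(congr1 (fun s : {poly rat} => s`_(size m).-2)) /eqP.
  rewrite coef_deriv coef0 -[(size m).-2.+1]/((size m).-2.+1)%N.
  rewrite prednK -?subn1 ?subn_gt0 // subn1 mulrn_eq0 -/(lead_coef m).
  by rewrite lead_coef_eq0 (negbTE m0) orbF; case: (size m) sm => [|[]].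
have := mmin m^`(); rewrite -deriv_map => /(_ dr) /(dvdp_leq d0).
by rewrite leqNgt lt_size_deriv.
Qed.

Lemma deriv_interior_min (K : realType) (f : {poly K}) (r : K) :
  (forall x, 0 <= x <= 1 -> 0 <= f.[x]) -> 0 < r < 1 -> root f r ->
  f^`().[r] = 0.
Proof.
move=> fge hr /eqP fr.
have D0 : is_derive r 1 (horner f) 0.
  apply: (@derive1_at_min K (horner f) 0 1 r) => //.
  by move=> t; rewrite in_itv /= fr => /andP[/ltW ? /ltW ?]; apply: fge; apply/andP.
by have <- := @derive_val _ _ _ _ _ _ _ (is_derive_poly f r); rewrite derive_val.
Qed.

Lemma ratr_horner_ge0 (K : realType) (q : {poly rat}) :
  (forall x : K, 0 <= x <= 1 -> 0 <= (map_poly ratr q).[x]) ->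
  forall (F : realFieldType) (p : F), 0 <= p <= 1 -> 0 <= (map_poly ratr q).[p].
Proof.
elim: (size q) {-2}q (leqnn (size q)) => [|n IH] {}q sq qge F p hp.
  by move: sq; rewrite leqn0 size_poly_eq0 => /eqP ->; rewrite map_poly0 horner0.
have [->|q0] := eqVneq q 0; first by rewrite map_poly0 horner0.
(* A factor nonnegative on the interval in every ordered field can be stripped: the cofactor stays
   nonnegative over [K] and is smaller. *)
have reduce (g h : {poly rat}) : q = g * h -> (1 < size g)%N ->
    (forall (T : realFieldType) (x : T), 0 <= x <= 1 -> 0 <= (map_poly ratr g).[x]) ->
    0 <= (map_poly ratr q).[p].
  move=> Dq sg gge.
  have g0 : g != 0 by rewrite -size_poly_gt0 ltnW.
  have h0 : h != 0 by apply: contraNneq q0 => h0; rewrite Dq h0 mulr0.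
  rewrite Dq rmorphM hornerM mulr_ge0 ?gge //; apply: IH => //.
    move: sq; rewrite Dq size_mul //; move: sg; case: (size g) => [|[|k]] // _.
    by rewrite !addSn /= ltnS; apply: leq_trans; rewrite leq_addl.
  apply: (@horner_ge0_factor K (map_poly ratr g)).
  - by rewrite map_poly_eq0.
  - exact: gge.
  - by rewrite -rmorphM -Dq.
have [[r [hr qr]]|nor] :=
  pselect (exists r : K, 0 <= r <= 1 /\ root (map_poly ratr q) r); last first.
  apply/ltW/(@ratr_horner_gt0 K q) => // x hx; rewrite lt_neqAle qge // andbT eq_sym.
  by apply/negP => qx; apply: nor; exists x.
have [r0|r0] := eqVneq r 0.
  move: qr; rewrite r0 -(rmorph0 ratr) fmorph_root => /factor_theorem[h Dq].
  apply: (reduce 'X h); rewrite ?size_polyX ?Dq ?subr0 1?mulrC //.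
  by move=> T x /andP[x0 _]; rewrite map_polyX hornerX.
have [r1|r1] := eqVneq r 1.
  move: qr; rewrite r1 -(rmorph1 ratr) fmorph_root => /factor_theorem[h Dq].
  apply: (reduce (1 - 'X) (- h)); first by rewrite Dq polyC1 -(opprB 'X) mulrNN mulrC.
    by rewrite -opprB size_polyN size_XsubC.
  by move=> T x /andP[_ x1]; rewrite rmorphB rmorph1 /= map_polyX !hornerE subr_ge0.
have [m [m0 mr mmin]] := ratr_minpoly q0 qr.
have mr' := deriv_minpoly_neq0 m0 mr mmin.
have /dvdpP[h Dq] := mmin _ qr.
(* An interior zero is a minimum, so the derivative of [q = h * m] vanishes at [r], leaving
   [h(r) * m'(r) = 0]. Hence [m] divides [h] as well. *)
have : root (map_poly ratr h) r.
  have ri : 0 < r < 1.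
    by case/andP: hr => ? ?; rewrite !lt_neqAle eq_sym r0 r1; apply/andP.
  have := deriv_interior_min qge ri qr.
  rewrite Dq rmorphM derivM !hornerE (rootP mr) mulr0 add0r => /eqP.
  by rewrite mulf_eq0 (negbTE mr') orbF.
move=> /mmin /dvdpP[k Dh].
apply: (reduce (m ^+ 2) k); first by rewrite Dq Dh -mulrA mulrC expr2.
  have sm : (1 < size m)%N.
    by rewrite -(size_map_poly (ratr : rat -> K)) (root_size_gt1 _ mr) ?map_poly_eq0.
  by rewrite expr2 size_mul //; move: sm; case: (size m) => [|[|k']]; rewrite // addnS.
by move=> T x _; rewrite rmorphXn horner_exp sqr_ge0.
Qed.

(** * Polynomials without zeros in a cone *)

(* The half-open half plane {r e^(i a) : r >= 0, 0 <= a < pi}: closed under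
   addition, yet never meeting the negative reals. *)
Definition cone (K : rcfType) (z : K[i]) : bool :=
  (0 < complex.Im z) || ((complex.Im z == 0) && (0 <= complex.Re z)).

Lemma cone0 (K : rcfType) : cone (0 : K[i]).
Proof. by rewrite /cone /= eqxx lexx orbT. Qed.

Lemma coneD (K : rcfType) (z w : K[i]) : cone z -> cone w -> cone (z + w).
Proof.
case: z w => [a b] [c d]; rewrite /cone /=.
case/orP => [b0|/andP[/eqP-> a0]]; case/orP => [d0|/andP[/eqP-> c0]].
- by rewrite addr_gt0.
- by rewrite addr0 b0.
- by rewrite add0r d0.
- by rewrite addr0 eqxx addr_ge0 ?orbT.
Qed.

Lemma cone_sum (K : rcfType) (I : Type) (s : seq I) (P : pred I) (F : I -> K[i]) :
  (forall i, P i -> cone (F i)) -> cone (\sum_(i <- s | P i) F i).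
Proof. by move=> FP; apply: (big_ind (@cone K)) => //; [exact: cone0|exact: coneD]. Qed.

Lemma cone_real (K : rcfType) (x : K) : 0 <= x -> cone x%:C%C.
Proof. by rewrite /cone /= eqxx => ->; rewrite orbT. Qed.

Lemma cone_scale (K : rcfType) (x : K) (z : K[i]) :
  0 <= x -> cone z -> cone (x%:C%C * z).
Proof.
rewrite le_eqVlt => /predU1P[<-|x0]; first by rewrite mul0r cone0.
case: z => a b; rewrite /cone /= !mul0r subr0 addr0.
case/orP => [b0|/andP[/eqP-> a0]]; first by rewrite mulr_gt0.
by rewrite mulr0 eqxx mulr_ge0 ?orbT // ltW.
Qed.

Lemma cone_addr_neq0 (K : rcfType) (x : K) (z : K[i]) :
  0 < x -> cone z -> x%:C%C + z != 0.
Proof.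
move=> x0; case: z => a b; rewrite /cone /= eq_complex /= negb_and add0r.
case/orP => [/gt_eqF ->|/andP[_ a0]]; first by rewrite orbT.
by rewrite gt_eqF // ltr_wpDr.
Qed.

(** The conjugate of [-1/z] is [-z/|z|^2], a negative multiple of [z], and the opposite of a point
    outside the cone lies in the cone. *)
Lemma cone_conj_invN (K : rcfType) (z : K[i]) : ~~ cone z -> cone (conjc (- z^-1)).
Proof.
case: z => a b; rewrite /cone /= negb_or negb_and -!leNgt -ltNge opprK.
case/andP=> b0 ab; have [b0'|b0'] := eqVneq b 0.
  have a0 : a < 0 by move: ab; rewrite b0' eqxx.
  rewrite b0' mul0r oppr0 ltxx eqxx /= expr0n /= addr0.
  by rewrite oppr_ge0 mulr_le0_ge0 ?invr_ge0 ?sqr_ge0 // ltW.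
have b1 : b < 0 by rewrite lt_neqAle b0'.
rewrite -mulNr divr_gt0 ?oppr_gt0 // ltr_wpDl ?sqr_ge0 //.
by rewrite lt_neqAle eq_sym sqrf_eq0 b0' sqr_ge0.
Qed.

(** Normalising at the origin makes the ratio of the first two coefficients the sum of the [a], the
    negated inverses of the roots. *)
Lemma poly_factor_at0 (C : closedFieldType) (P : {poly C}) : P.[0] != 0 ->
  exists s : seq C, [/\ size s = (size P).-1,
    P = P.[0] *: \prod_(a <- s) (1 + a *: 'X) &
    forall a, a \in s -> a != 0 /\ root P (- a^-1)].
Proof.
move=> P0; have [r Dr] := closed_field_poly_normal P.
have lc0 : lead_coef P != 0.
  apply: contraNneq P0 => lc0; move/eqP: lc0; rewrite lead_coef_eq0 => /eqP ->.
  by rewrite horner0.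
have rootr z : z \in r -> root P z.
  by move=> zr; rewrite Dr rootZ // root_prod_XsubC.
have r0 z : z \in r -> z != 0.
  by move=> /rootr zr; apply: contraNneq P0 => z0; move/rootP: zr; rewrite z0 => ->.
exists [seq - z^-1 | z <- r]; split.
- by rewrite size_map Dr size_scale // size_prod_XsubC.
- have DP : P = (lead_coef P * \prod_(z <- r) (- z)) *:
      \prod_(a <- [seq - z^-1 | z <- r]) (1 + a *: 'X).
    rewrite {1}Dr -scalerA big_map; congr (_ *: _).
    rewrite -scaler_prod big_seq [RHS]big_seq; apply: eq_bigr => z zr.
    by rewrite scalerDr scalerA mulrNN mulfV ?r0 // scale1r addrC alg_polyC polyCN.
  suff -> : P.[0] = lead_coef P * \prod_(z <- r) (- z) by [].
  rewrite {1}DP hornerZ horner_prod [X in _ * X = _]big1 ?mulr1 // => a _.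
  by rewrite !hornerE ?mulr0 ?addr0.
- move=> a /mapP[z zr ->]; rewrite oppr_eq0 invr_eq0 r0 //.
  by rewrite invrN opprK invrK; split=> //; apply: rootr.
Qed.

Lemma coef01_prod_1DX (A : comNzRingType) (s : seq A) :
  (\prod_(a <- s) (1 + a *: 'X))`_0 = 1 /\
  (\prod_(a <- s) (1 + a *: 'X))`_1 = \sum_(a <- s) a.
Proof.
elim: s => [|a s [IH0 IH1]]; first by rewrite !big_nil !coef1.
rewrite !big_cons !coefM !big_ord_recl !big_ord0 /= !subn0 IH0 IH1.
by rewrite !coefE /=; split; ring.
Qed.

(** Up to the factor [P.[0]] the value is [b] plus the sum of the [-1/z] over the roots [z]. Roots
    avoid the cone, so the conjugates of these terms lie in it, and a positive real plus a cone
    element is never 0. *)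
Lemma cone_boundary_operator (K : rcfType) (P : {poly K[i]}) (b : K) : 0 < b ->
  (forall z, cone z -> P.[z] != 0) -> b%:C%C * P`_0 + P`_1 != 0.
Proof.
move=> b0 hP; have P0 := hP 0 (cone0 K).
have [s [_ DP hs]] := poly_factor_at0 P0.
have [c0 c1] := coef01_prod_1DX s.
rewrite DP !coefZ c0 c1 mulr1 mulrC -mulrDr mulf_neq0 // -conjc_eq0.
have -> : conjc (b%:C%C + \sum_(a <- s) a) = b%:C%C + \sum_(a <- s) conjc a.
  by rewrite rmorphD rmorph_sum /= oppr0.
rewrite cone_addr_neq0 // big_seq.
apply: cone_sum => a /hs[a0 ra].
have -> : a = - (- a^-1)^-1 by rewrite invrN invrK opprK.
by apply/cone_conj_invN/(contraL _ ra) => /hP.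
Qed.

Lemma cone_poly_le (K : rcfType) (f : {poly K}) (d : nat) : (0 < d)%N ->
  (size f <= d.+1)%N -> 0 < f`_0 ->
  (forall z, cone z -> (map_poly (real_complex K) f).[z] != 0) ->
  forall x, 0 <= x -> f.[x] <= f`_0 * (1 + f`_1 / f`_0 * x / d%:R) ^+ d.
Proof.
move=> d0 sf f0 hf x x0.
set P := map_poly _ f in hf.
have [s [ss DP hs]] := poly_factor_at0 (hf 0 (cone0 K)).
have P0 : P.[0] = (f`_0)%:C%C.
  by rewrite -(rmorph0 (real_complex K)) horner_map horner_coef0.
(* The coefficients are real, so a root and its conjugate both avoid the cone; hence [a] and its
   conjugate both lie in it, which forces [a] real and nonnegative. *)
have hs' a : a \in s -> 0 <= complex.Re a /\ a = (complex.Re a)%:C%C.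
  move=> /hs[a0 ra].
  have ra' : root P (conjc (- a^-1)).
    have -> : P = map_poly conjc P.
      by apply/polyP => i; rewrite !coef_map /= oppr0.
    by rewrite (fmorph_root (conjc : {rmorphism _ -> _})).
  have n1 : ~~ cone (- a^-1) by apply: contraL ra => /hf.
  have n2 : ~~ cone (conjc (- a^-1)) by apply: contraL ra' => /hf.
  have := cone_conj_invN n1; have := cone_conj_invN n2.
  rewrite rmorphN fmorphV /= conjcK !invrN !opprK !invrK.
  case: (a) => u v; rewrite /cone /= oppr_gt0 oppr_eq0.
  case/orP => [v0|/andP[/eqP-> u0]]; last by split.
  by case/orP => [?|/andP[/eqP v1 _]]; move: v0; rewrite ?v1 ?ltxx // ltNge ltW.
pose t := [seq complex.Re a | a <- s].
have Df : f = f`_0 *: \prod_(a <- t) (1 + a *: 'X).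
  apply: (map_poly_inj (real_complex K)); rewrite -/P [LHS]DP P0.
  rewrite linearZ /= rmorph_prod /= big_map; congr (_ *: _).
  rewrite big_seq [RHS]big_seq; apply: eq_bigr => a /hs'[_ Da].
  by rewrite {1}Da rmorphD rmorph1 /= map_polyZ map_polyX.
have [_ c1] := coef01_prod_1DX t.
have f1 : f`_1 / f`_0 = \sum_(a <- t) a.
  by rewrite {1}Df coefZ c1 mulrC mulKf ?gt_eqF.
have st : (size t <= d)%N.
  by rewrite size_map ss size_map_poly; move: sf; case: (size f).
(* Past its end [t] reads as 0, which gives factors equal to 1; this pads the product to exactly [d]
   factors for AM-GM. *)
have sumE (g : K -> K) : g 0 = 0 -> \sum_(a <- t) g a = \sum_(i < d) g t`_i.
  move=> g0; rewrite (big_nth 0) big_mkord (big_ord_widen d (fun i => g t`_i) st).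
  rewrite [RHS](bigID (fun i : 'I_d => (i < size t)%N)) /=.
  by rewrite [X in _ = _ + X]big1 ?addr0 // => i; rewrite -leqNgt => /(nth_default 0) ->.
have prodE (g : K -> K) : g 0 = 1 -> \prod_(a <- t) g a = \prod_(i < d) g t`_i.
  move=> g0; rewrite (big_nth 0) big_mkord (big_ord_widen d (fun i => g t`_i) st).
  rewrite [RHS](bigID (fun i : 'I_d => (i < size t)%N)) /=.
  by rewrite [X in _ = _ * X]big1 ?mulr1 // => i; rewrite -leqNgt => /(nth_default 0) ->.
rewrite {1}Df hornerZ ler_pM2l // horner_prod.
under eq_bigr do rewrite !hornerE.
rewrite (prodE (fun a => 1 + a * x)) ?mul0r ?addr0 //.
have t0 (i : 'I_d) : 0 <= t`_i.
  have [it|it] := ltnP i (size t); last by rewrite nth_default.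
  by have /mapP[a /hs'[a0 _] ->] := mem_nth 0 it.
have := @leif_AGM K 'I_d 'I_d (fun i => 1 + t`_i * x).
case=> [i _|]; first by rewrite addr_ge0 ?mulr_ge0.
rewrite card_ord => + _; congr (_ <= _ ^+ _).
rewrite big_split /= sumr_const card_ord -mulr_suml f1 (sumE id) // mulrDl.
by rewrite mulfV // pnatr_eq0 -lt0n.
Qed.

(** * Assignment sums *)

Section AssignmentSum.
Variables (L J : finType) (b : L -> J -> bool).

Definition fiber_card (phi : {ffun L -> option J}) (j : J) : nat :=
  #|[set i | phi i == Some j]|.

Definition edge_weight (S : comNzRingType) (q t : S) (i : L) (o : option J) : S :=
  if o is Some j then t *+ b i j else q.

(* Applies to the product over i of (q + t * sum of the adjacent x_j) the linear
   functional that sends the monomial prod_j x_j^(c_j) to prod_j u_j(c_j). *)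
Definition assignment_sum (S : comNzRingType) (q t : S) (u : J -> nat -> S) : S :=
  \sum_(phi : {ffun L -> option J})
    (\prod_i edge_weight q t i (phi i)) * \prod_j u j (fiber_card phi j).

Definition update (T : Type) (u : J -> T) (j : J) (v : T) : J -> T :=
  fun k => if k == j then v else u k.

Arguments update : simpl never.

(* The functional g |-> q g(0) + g'(0), as a function of the exponent. *)
Definition elim_op (S : comNzRingType) (q : S) (c : nat) : S :=
  if c == 0%N then q else (c == 1%N)%:R.

(* Variables in [A] are eliminated, the others are evaluated at [x]. *)
Definition partial_op (S : comNzRingType) (q : S) (A : {set J}) (x : J -> S) (j : J) : nat -> S :=
  if j \in A then elim_op q else fun c => x j ^+ c.

Lemma eq_assignment_sum (S : comNzRingType) (q t : S) (u v : J -> nat -> S) :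
  u =2 v -> assignment_sum q t u = assignment_sum q t v.
Proof. by move=> uv; apply: eq_bigr => phi _; congr (_ * _); apply: eq_bigr. Qed.

Lemma rmorph_assignment_sum (S S' : comNzRingType) (f : {rmorphism S -> S'}) q t u :
  f (assignment_sum q t u) =
    assignment_sum (f q) (f t) (fun j c => f (u j c)).
Proof.
rewrite rmorph_sum; apply: eq_bigr => phi _; rewrite rmorphM !rmorph_prod.
congr (_ * _); apply: eq_bigr => i _.
by rewrite /edge_weight; case: (phi i) => // j; rewrite rmorphMn.
Qed.

Lemma assignment_sum_ge0 (K : realFieldType) (q t : K) (u : J -> nat -> K) :
  0 <= q -> 0 <= t -> (forall j c, 0 <= u j c) -> 0 <= assignment_sum q t u.
Proof.
move=> q0 t0 u0; apply: sumr_ge0 => phi _; rewrite mulr_ge0 ?prodr_ge0 // => i _.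
by rewrite /edge_weight; case: (phi i) => // j; rewrite mulrn_wge0.
Qed.

(** Expanding the product, each [i] picks [q] ([None]) or one variable ([Some j]); collecting the
    picks by [j] gives the exponents. *)
Lemma assignment_sum_exp (S : comNzRingType) (q t : S) (x : J -> S) :
  assignment_sum q t (fun j c => x j ^+ c) =
    \prod_i (q + \sum_(j | b i j) t * x j).
Proof.
pose g i (o : option J) := edge_weight q t i o * (if o is Some j then x j else 1).
transitivity (\prod_i \sum_o g i o); last first.
  apply: eq_bigr => i _; rewrite (bigD1 None) //= /g mulr1; congr (_ + _).
  rewrite (reindex_omap Some id) /=; last by case.
  under eq_bigl do rewrite eqxx.
  rewrite [RHS]big_mkcond; apply: eq_bigr => j _.
  by case: (b i j); rewrite ?mulr0n ?mul0r.
rewrite bigA_distr_bigA; apply: eq_bigr => phi _; rewrite big_split; congr (_ * _).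
transitivity (\prod_j \prod_i (if phi i == Some j then x j else 1)).
  apply: eq_bigr => j _; rewrite -big_mkcond prodr_const; congr (_ ^+ _).
  by rewrite /fiber_card cardsE.
rewrite exchange_big; apply: eq_bigr => i _; rewrite -big_mkcond /=.
case: (phi i) => [j|]; last by rewrite big1.
by rewrite (big_pred1 j) // => k; rewrite /= (inj_eq (@Some_inj _)) eq_sym.
Qed.

(* The dependence on the variable [j], the others being treated according to [u]. *)
Definition elim_poly (S : comNzRingType) (q t : S) (u : J -> nat -> S) (j : J) : {poly S} :=
  \poly_(c < #|[set i | b i j]|.+1)
    assignment_sum q t (update u j (fun n => (n == c)%:R)).

Lemma assignment_sum_update (S : comNzRingType) (q t : S) (u : J -> nat -> S) j v :
  assignment_sum q t (update u j v) =
    \sum_(c < #|[set i | b i j]|.+1) (elim_poly q t u j)`_c * v c.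
Proof.
under eq_bigr => c _ do rewrite coef_poly ltn_ord mulr_suml.
rewrite exchange_big; apply: eq_bigr => phi _ /=.
have updE v' : \prod_k update u j v' k (fiber_card phi k) =
    v' (fiber_card phi j) * \prod_(k | k != j) u k (fiber_card phi k).
  rewrite (bigD1 j) //= /update eqxx; congr (_ * _).
  by apply: eq_bigr => k /negbTE ->.
rewrite [RHS](eq_bigr (fun c : 'I__ => \prod_i edge_weight q t i (phi i) *
  ((fiber_card phi j == c)%:R * \prod_(k | k != j) u k (fiber_card phi k)) * v c));
  last by move=> c _; rewrite updE.
rewrite updE; have [le|lt] := leqP (fiber_card phi j) #|[set i | b i j]|.
  rewrite (bigD1 (Ordinal (le : (fiber_card phi j < _.+1)%N))) //= eqxx mul1r.
  rewrite [X in _ = _ + X]big1 ?addr0; first by rewrite [v _ * _]mulrC mulrA.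
  by move=> c /negbTE; rewrite -val_eqE /= eq_sym => ->; rewrite mul0r mulr0 mul0r.
(* A fibre larger than the degree of [j] contains a non-neighbour of [j], whose weight is 0. *)
suff -> : \prod_i edge_weight q t i (phi i) = 0.
  by rewrite mul0r big1 // => c _; rewrite !mul0r.
have /subsetPn[i ip ib] : ~~ ([set i | phi i == Some j] \subset [set i | b i j]).
  by apply: contraTN lt => /subset_leq_card; rewrite leqNgt.
move: ip ib; rewrite !inE => /eqP Di /negbTE bij.
by rewrite (bigD1 i) //= Di /= bij mulr0n mul0r.
Qed.

Lemma horner_elim_poly (S : comNzRingType) (q t : S) (u : J -> nat -> S) j z :
  (elim_poly q t u j).[z] =
    assignment_sum q t (update u j (fun c => z ^+ c)).
Proof.
rewrite assignment_sum_update (horner_coef_wide _ (size_poly _ _)).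
by apply: eq_bigr => c _.
Qed.

Lemma elim_poly_coef01 (S : comNzRingType) (q t : S) (u : J -> nat -> S) j :
  (0 < #|[set i | b i j]|)%N ->
  assignment_sum q t (update u j (elim_op q)) =
    q * (elim_poly q t u j)`_0 + (elim_poly q t u j)`_1.
Proof.
rewrite assignment_sum_update; case: #|_| => // m _.
rewrite !big_ord_recl big1 ?addr0 /= /elim_op /= ?mulr1 1?mulrC //.
by move=> i _; rewrite mulr0.
Qed.

Lemma map_elim_poly (S S' : comNzRingType) (f : {rmorphism S -> S'}) q t u j :
  map_poly f (elim_poly q t u j) =
    elim_poly (f q) (f t) (fun k c => f (u k c)) j.
Proof.
apply/polyP => c; rewrite coef_map !coef_poly; case: ifP => _; last exact: rmorph0.
rewrite [LHS](rmorph_assignment_sum f); apply: eq_assignment_sum => k n.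
by rewrite /update; case: ifP => //= _; rewrite rmorph_nat.
Qed.

Lemma partial_opU1 (S : comNzRingType) (q : S) (A : {set J}) (x : J -> S) j :
  partial_op q (j |: A) x =2 update (partial_op q A x) j (elim_op q).
Proof. by move=> k c; rewrite /partial_op /update in_setU1; case: eqP. Qed.

Lemma partial_op_update (S : comNzRingType) (q : S) (A : {set J}) (x : J -> S) j z :
  j \notin A ->
  update (partial_op q A x) j (fun c => z ^+ c) =2 partial_op q A (update x j z).
Proof.
move=> jA k c; rewrite /partial_op /update.
by case: eqP => // ->; rewrite (negbTE jA).
Qed.

Lemma finset_setU1_ind (P : {set J} -> Prop) : P set0 ->
  (forall j (A : {set J}), j \notin A -> P A -> P (j |: A)) -> forall A, P A.
Proof.
move=> P0 PU A; have [n] := ubnP #|A|; elim: n A => // n IH A lt.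
have [->//|[j jA]] := set_0Vmem A; rewrite -(setD1K jA); apply: PU.
  by rewrite !inE eqxx.
by apply: IH; move: lt; rewrite (cardsD1 j A) jA.
Qed.

Hypothesis b_gt0 : forall j, (0 < #|[set i | b i j]|)%N.

(** With nothing eliminated, each factor is a positive real plus a cone element. Eliminating one
    more variable is the one-variable operator applied to a polynomial without zeros in the cone. *)
Lemma assignment_sum_neq0 (K : rcfType) (q t : K) (A : {set J}) (x : J -> K[i]) :
  0 < q -> 0 <= t -> (forall j, cone (x j)) ->
  assignment_sum q%:C%C t%:C%C (partial_op q%:C%C A x) != 0.
Proof.
move=> q0 t0; elim/finset_setU1_ind: A x => [|j A jA IH] x hx.
  rewrite (eq_assignment_sum _ _ (v := fun j c => x j ^+ c)); last first.
    by move=> j c; rewrite /partial_op inE.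
  rewrite assignment_sum_exp; apply/prodf_neq0 => i _; apply: cone_addr_neq0 => //.
  by apply: cone_sum => j _; apply: cone_scale.
rewrite (eq_assignment_sum _ _ (partial_opU1 _ _ _ _)) elim_poly_coef01 //.
apply: cone_boundary_operator => // z hz; rewrite horner_elim_poly.
rewrite (eq_assignment_sum _ _ (partial_op_update _ _ _ jA)).
by apply: IH => k; rewrite /update; case: eqP.
Qed.

End AssignmentSum.

(** * The capacity bound *)

(* Uses the tangent to [expR] at the weighted mean of the [v i]. *)
Lemma expR_weighted_mean (K : realType) (I : Type) (s : seq I) (P : pred I)
    (w : K) (a v : I -> K) :
  0 <= w -> (forall i, 0 <= a i) -> w + \sum_(i <- s | P i) a i = 1 ->
  expR (\sum_(i <- s | P i) a i * v i) <= w + \sum_(i <- s | P i) a i * expR (v i).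
Proof.
move=> w0 a0 sum1; set m := \sum_(i <- s | P i) a i * v i.
have tangent x : expR m * (1 + x - m) <= expR x.
  have -> : expR x = expR m * expR (x - m) by rewrite -expRD addrC subrK.
  by rewrite ler_pM2l ?expR_gt0 // -addrA expR_ge1Dx.
(* The weight [w] sits at the point 0, where the exponential is 1. *)
have h0 : w * (expR m * (1 - m)) <= w.
  by rewrite -[leRHS]mulr1 ler_wpM2l // -[X in _ <= X]expR0 -{1}[1]addr0 tangent.
have h1 : \sum_(i <- s | P i) a i * (expR m * (1 + v i - m)) <=
    \sum_(i <- s | P i) a i * expR (v i).
  by apply: ler_sum => i _; rewrite ler_wpM2l.
apply: le_trans (lerD h0 h1).
have -> : \sum_(i <- s | P i) a i * (expR m * (1 + v i - m)) =
    expR m * ((1 - m) * (\sum_(i <- s | P i) a i) + m).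
  rewrite mulrDr /m !mulr_sumr -big_split; apply: eq_bigr => i _ /=; ring.
have -> : \sum_(i <- s | P i) a i = 1 - w by rewrite -sum1 addrC addKr.
by rewrite le_eqVlt; apply/orP; left; apply/eqP; ring.
Qed.

(* The optimal [v] makes [1 + a1 / a0 * expR v / d%:R] equal to the inverse of
   [1 - p / d%:R]; it does not exist when [a1 = 0], where [v] is taken large. *)
Lemma capacity_step (K : realType) (p : K) (d : nat) (a0 a1 c : K) :
  0 < p < 1 -> (0 < d)%N -> 0 < a0 -> 0 <= a1 ->
  (forall v, expR (c + p * v) <= a0 * (1 + a1 / a0 * expR v / d%:R) ^+ d) ->
  expR (c + (d%:R - p) * ln (1 - p / d%:R)) <= (1 - p) * a0 + a1.
Proof.
move=> /andP[p0 p1] d0 a00 a10 bound.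
have dR : 1 <= d%:R :> K by rewrite ler1n.
have dp : 0 < d%:R :> K by exact: lt_le_trans dR.
have q0 : 0 < 1 - p / d%:R.
  by rewrite subr_gt0 ltr_pdivrMr // mul1r (lt_le_trans p1).
set l := ln (1 - p / d%:R).
have el : expR l = 1 - p / d%:R by rewrite lnK // posrE.
move: a10; rewrite le_eqVlt => /predU1P[a10|a1p].
  (* At this point the left side is [a0 * expR 1], while the right side is the constant [a0]. *)
  have := bound ((ln a0 + 1 - c) / p).
  rewrite -a10 !mul0r addr0 expr1n mulr1 [p * _]mulrC divfK ?gt_eqF // addrC subrK.
  rewrite expRD lnK ?posrE // -[leRHS]mulr1 ler_pM2l // leNgt => /negP[].
  by rewrite -[ltLHS]expR0 ltr_expR.
pose s := a1 / a0; have s0 : 0 < s by rewrite divr_gt0.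
have ps : 0 < p / s by rewrite divr_gt0.
have := bound (ln (p / s) - l).
have -> : 1 + a1 / a0 * expR (ln (p / s) - l) / d%:R = expR (- l).
  rewrite -/s expRD lnK ?posrE // !expRN el.
  have h1 : d%:R - p != 0 by rewrite gt_eqF // subr_gt0 (lt_le_trans p1).
  have h2 : d%:R != 0 :> K by rewrite gt_eqF.
  have -> : 1 - p / d%:R = (d%:R - p) / d%:R by rewrite mulrBl divff.
  have h3 : s != 0 by rewrite gt_eqF.
  by field; rewrite h1 h2 h3.
rewrite -expRM_natl => bnd.
(* Two-point AM-GM: weight [1 - p] at the value 1 and weight [p] at the value [s / p]. *)
have amgm : expR (p * ln (s / p)) <= (1 - p) + s.
  have := @expR_weighted_mean K _ [:: tt] xpredT (1 - p) (fun=> p) (fun=> ln (s / p)).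
  rewrite !big_seq1 lnK ?posrE ?divr_gt0 // [p * (s / p)]mulrC divfK ?gt_eqF //.
  by apply; rewrite ?subr_ge0 ?subrK // ltW.
have -> : (1 - p) * a0 + a1 = a0 * ((1 - p) + s).
  by rewrite mulrDr [a0 * s]mulrC /s divfK ?gt_eqF // mulrC.
apply: le_trans (_ : a0 * expR (p * ln (s / p)) <= _); last by rewrite ler_pM2l.
have -> : c + (d%:R - p) * l =
    (c + p * (ln (p / s) - l)) + d%:R * l + p * ln (s / p).
  by rewrite !ln_div ?posrE //; ring.
rewrite expRD ler_pM2r ?expR_gt0 // expRD.
apply: le_trans (ler_wpM2r (expR_ge0 _) bnd) _.
by rewrite -mulrA -expRD mulrN addNr expR0 mulr1.
Qed.

(** In the factor of [i], the weight [1 - p] on 1 and the weights [p/d] on the [d] values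
    [(1 - p/d) * x_j] sum to 1, so weighted AM-GM applies. In the product over [i] each [j] occurs
    [d] times. Logarithms [u] replace real powers. *)
Lemma capacity_bound0 (K : realType) (L J : finType) (b : L -> J -> bool)
    (d : nat) (p : K) (u : J -> K) :
  0 < p < 1 -> (0 < d)%N -> (forall i, #|[set j | b i j]| = d) ->
  (forall j, #|[set i | b i j]| = d) ->
  expR (#|L|%:R * (p * ln (1 - p / d%:R)) + p * \sum_j u j) <=
  assignment_sum b (1 - p) (p / d%:R * (1 - p / d%:R))
    (fun j c => expR (u j) ^+ c).
Proof.
move=> hp d0 degL degJ; have /andP[p0 p1] := hp.
have dR : 1 <= d%:R :> K by rewrite ler1n.
have dp : 0 < d%:R :> K by exact: lt_le_trans dR.
have q0 : 0 < 1 - p / d%:R.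
  by rewrite subr_gt0 ltr_pdivrMr // mul1r (lt_le_trans p1).
set l := ln (1 - p / d%:R); set t := p / d%:R * (1 - p / d%:R).
have el : expR l = 1 - p / d%:R by rewrite lnK // posrE.
have pd0 : 0 < p / d%:R by rewrite divr_gt0.
have p1' : 0 < 1 - p by rewrite subr_gt0.
have sumL i (x : K) : \sum_(j | b i j) x = x *+ d.
  by rewrite -(degL i) -sumr_const; apply: eq_bigl => j; rewrite inE.
have sumJ j (x : K) : \sum_(i | b i j) x = x *+ d.
  by rewrite -(degJ j) -sumr_const; apply: eq_bigl => i; rewrite inE.
rewrite assignment_sum_exp.
have -> : #|L|%:R * (p * l) + p * \sum_j u j =
    \sum_(i : L) \sum_(j | b i j) (p / d%:R) * (u j + l).
  under [in RHS]eq_bigr => i _ do rewrite -mulr_sumr big_split /= mulrDr.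
  rewrite big_split /= [LHS]addrC; congr (_ + _).
    rewrite -mulr_sumr (exchange_big_dep xpredT) //=.
    under [in RHS]eq_bigr => j _ do rewrite sumJ.
    by rewrite sumrMnl -[X in _ = _ * X]mulr_natl mulrA divfK ?gt_eqF.
  under [in RHS]eq_bigr => i _ do rewrite sumL.
  rewrite sumr_const -[RHS]mulr_natl; congr (_ * _).
  by rewrite -[l *+ d]mulr_natl mulrA divfK ?gt_eqF.
rewrite expR_sum; apply: ler_prod => i _; rewrite expR_ge0 /=.
have -> : \sum_(j | b i j) t * expR (u j) =
    \sum_(j | b i j) p / d%:R * expR (u j + l).
  by apply: eq_bigr => j _; rewrite expRD el /t mulrA mulrAC.
apply: expR_weighted_mean => [|_|]; rewrite ?(ltW p1') ?(ltW pd0) //.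
by rewrite sumL -[X in _ + X]mulr_natr divfK ?gt_eqF // subrK.
Qed.

Lemma elim_poly_cone_neq0 (L J : finType) (b : L -> J -> bool)
    (b_gt0 : forall j, (0 < #|[set i | b i j]|)%N) (K : rcfType) (q t : K)
    (A : {set J}) (x : J -> K) (j : J) :
  0 < q -> 0 <= t -> (forall k, 0 <= x k) -> j \notin A -> forall z, cone z ->
  (map_poly (real_complex K)
     (elim_poly b q t (partial_op q A x) j)).[z] != 0.
Proof.
move=> q0 t0 x0 jA z hz; rewrite map_elim_poly horner_elim_poly.
rewrite (eq_assignment_sum _ _ _ (v := partial_op q%:C%C A
  (update (fun k => (x k)%:C%C) j z))).
  apply: assignment_sum_neq0 => // k; rewrite /update.
  by case: eqP => // _; rewrite cone_real.
move=> k c; rewrite /update /partial_op /elim_op.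
case: eqP => [->|_]; first by rewrite (negbTE jA).
case: ifP => _; last by rewrite rmorphXn.
by case: ifP => _ //; rewrite rmorph_nat.
Qed.

(** Gathers what one elimination requires; [a.1] and [a.2] are the constant and linear coefficients
    in [x_j]. *)
Lemma partial_op_elim (K : rcfType) (L J : finType) (b : L -> J -> bool)
    (d : nat) (q t : K) (A : {set J}) (x : J -> K) (j : J) :
  (0 < d)%N -> (forall k, #|[set i | b i k]| = d) -> 0 < q -> 0 <= t ->
  (forall k, 0 <= x k) -> j \notin A ->
  exists a : K * K, [/\ 0 < a.1, 0 <= a.2,
    assignment_sum b q t (partial_op q (j |: A) x) = q * a.1 + a.2 &
    forall z, 0 <= z ->
      assignment_sum b q t (partial_op q A (update x j z)) <=
      a.1 * (1 + a.2 / a.1 * z / d%:R) ^+ d].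
Proof.
move=> d0 degJ q0 t0 x0 jA.
have degJ0 k : (0 < #|[set i | b i k]|)%N by rewrite degJ.
have w0 k c : 0 <= partial_op q A x k c.
  rewrite /partial_op /elim_op; case: ifP => _; last by rewrite exprn_ge0.
  by case: ifP => _ //; exact: ltW.
have fcone := elim_poly_cone_neq0 degJ0 q0 t0 x0 jA.
pose f := elim_poly b q t (partial_op q A x) j.
(* Nonzero because 0 lies in the cone, nonnegative because all weights are. *)
have f0 : 0 < f`_0.
  rewrite lt_neqAle eq_sym -horner_coef0; apply/andP; split.
    have := fcone 0 (cone0 K).
    by rewrite -(rmorph0 (real_complex K)) horner_map fmorph_eq0.
  rewrite horner_elim_poly; apply: assignment_sum_ge0 => //; first exact: ltW.
  by move=> k c; rewrite /update; case: eqP => _ //; exact: exprn_ge0.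
exists (f`_0, f`_1); split => //=.
- rewrite coef_poly; case: ifP => // _; apply: assignment_sum_ge0 => //; first exact: ltW.
  by move=> k c; rewrite /update; case: eqP => _ //; exact: ler0n.
- rewrite (eq_assignment_sum _ _ _ (partial_opU1 _ _ _ _)).
  by rewrite elim_poly_coef01.
- move=> z z0.
  rewrite -(eq_assignment_sum _ _ _ (partial_op_update _ _ _ jA)).
  rewrite -horner_elim_poly; apply: cone_poly_le => //.
  by rewrite -(degJ j) size_poly.
Qed.

Lemma capacity_bound (K : realType) (L J : finType) (b : L -> J -> bool)
    (d : nat) (p : K) (A : {set J}) (u : J -> K) :
  0 < p < 1 -> (0 < d)%N -> (forall i, #|[set j | b i j]| = d) ->
  (forall j, #|[set i | b i j]| = d) ->
  expR (#|L|%:R * (p * ln (1 - p / d%:R)) +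
        #|A|%:R * ((d%:R - p) * ln (1 - p / d%:R)) +
        p * \sum_(j | j \notin A) u j) <=
  assignment_sum b (1 - p) (p / d%:R * (1 - p / d%:R))
    (partial_op (1 - p) A (fun j => expR (u j))).
Proof.
move=> hp d0 degL degJ; have /andP[p0 p1] := hp.
have dR : 1 <= d%:R :> K by rewrite ler1n.
have dp : 0 < d%:R :> K by exact: lt_le_trans dR.
have q0 : 0 < 1 - p / d%:R.
  by rewrite subr_gt0 ltr_pdivrMr // mul1r (lt_le_trans p1).
set l := ln (1 - p / d%:R); set t := p / d%:R * (1 - p / d%:R).
have pd0 : 0 < p / d%:R by rewrite divr_gt0.
have t0 : 0 <= t by rewrite ltW // mulr_gt0.
have p1' : 0 < 1 - p by rewrite subr_gt0.
elim/(@finset_setU1_ind J): A u => [|j A jA IH] u.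
  rewrite (eq_assignment_sum _ _ _ (v := fun j c => expR (u j) ^+ c)); last first.
    by move=> j c; rewrite /partial_op inE.
  rewrite cards0 mul0r addr0 (eq_bigl xpredT); last by move=> j; rewrite inE.
  exact: capacity_bound0.
have [[a0 a1] [/= a00 a10 -> ale]] := partial_op_elim (x := fun k => expR (u k)) d0 degJ
  p1' t0 (fun k => expR_ge0 (u k)) jA.
rewrite cardsU1 jA natrD.
have -> (s y r e : K) : s + (1 + r) * y + e = (s + e + r * y) + y by ring.
apply: capacity_step => // v.
(* The induction hypothesis is used with the logarithm of [x_j] set to an arbitrary [v], as the
   elimination step demands. *)
apply: le_trans (ale _ (expR_ge0 v)).
rewrite (eq_assignment_sum _ _ _ (v := partial_op (1 - p) A
  (fun k => expR (update u j v k)))); last first.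
  by move=> k n; rewrite /partial_op /update; case: eqP.
apply: le_trans (IH _); rewrite ler_expR.
rewrite [X in _ <= _ + p * X](bigD1 j) //= {1}/update eqxx /=.
have -> : \sum_(k | (k \notin A) && (k != j)) update u j v k =
    \sum_(k | k \notin j |: A) u k; last first.
  have -> (r s y e : K) : r + p * e + s + y = r + s + (y + p * e) by ring.
  by rewrite mulrDr.
apply: eq_big => [k|k /andP[_ kj]].
  by rewrite in_setU1 negb_or andbC.
by rewrite /update (negbTE kj).
Qed.

(** * Matchings as assignments *)

Section MatchingAssignment.
Variables (V : finType) (e : rel V) (col : V -> bool).
Hypothesis e_sym : forall x y, e x y = e y x.
Hypothesis e_col : forall x y, e x y -> col x != col y.

Definition left_vertex : finType := {x : V | col x}.
Definition right_vertex : finType := {x : V | ~~ col x}.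
Definition adj (i : left_vertex) (j : right_vertex) : bool := e (val i) (val j).

Lemma left_right_neq (i : left_vertex) (j : right_vertex) : (val i == val j) = false.
Proof. by apply: contraNF (valP j) => /eqP <-; exact: (valP i). Qed.

Lemma left_right_pair_inj (i i' : left_vertex) (j j' : right_vertex) :
  [set val i; val j] = [set val i'; val j'] -> i = i' /\ j = j'.
Proof.
move=> /setP E; have := E (val i); have := E (val j).
rewrite !inE !eqxx orbT /= left_right_neq orbF [val j == val i']eq_sym left_right_neq /=.
by move=> /esym/eqP/val_inj -> /esym/eqP/val_inj ->.
Qed.

Lemma adj_pair (i : left_vertex) (j : right_vertex) :
  is_edge e [set val i; val j] = adj i j.
Proof.
apply/existsP/idP => [[x /existsP[y /andP[exy /eqP E]]]|ij]; last first.
  by exists (val i); apply/existsP; exists (val j); rewrite eqxx andbT.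
have := e_col exy; case cx: (col x) => cy.
  have cy' : ~~ col y by move: cy; case: (col y).
  have [-> ->] := @left_right_pair_inj i (Sub x cx) j (Sub y cy') E.
  by rewrite /adj.
have cy' : col y by move: cy; case: (col y).
rewrite [RHS]setUC in E.
have [-> ->] := @left_right_pair_inj i (Sub y cy') j (Sub x (negbT cx)) E.
by rewrite /adj e_sym.
Qed.

Lemma is_edge_pair (E : {set V}) :
  is_edge e E -> exists i, exists j, E = [set val (i : left_vertex); val (j : right_vertex)].
Proof.
case/existsP => x /existsP[y /andP[exy /eqP ->]].
have := e_col exy; case cx: (col x) => cy.
  have cy' : ~~ col y by move: cy; case: (col y).
  by exists (Sub x cx), (Sub y cy').
have cy' : col y by move: cy; case: (col y).
by exists (Sub y cy'), (Sub x (negbT cx)); rewrite setUC.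
Qed.

Notation assignment := {ffun left_vertex -> option right_vertex}.

Definition dom (phi : assignment) : {set left_vertex} := [set i | phi i != None].

Definition graph (phi : assignment) (i : left_vertex) : {set V} :=
  if phi i is Some j then [set val i; val j] else set0.

(** Only edges are used and no right vertex is used twice; on the left, disjointness is automatic
    since [phi] is a function. *)
Definition valid (phi : assignment) : bool :=
  [forall i, if phi i is Some j then adj i j else true] &&
  [forall j, (fiber_card phi j <= 1)%N].

Lemma graphE (phi : assignment) i j :
  ([set val i; val j] \in graph phi @: dom phi) = (phi i == Some j).
Proof.
apply/imsetP/eqP => [[i']|phii]; last first.
  by exists i; rewrite ?inE /graph phii.
rewrite inE /graph; case phi': (phi i') => [j'|] // _ /left_right_pair_inj[-> ->].
exact: phi'.
Qed.

Lemma graph_inj : injective (fun phi : assignment => graph phi @: dom phi).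
Proof.
move=> phi psi /setP E; apply/ffunP => i.
have {}E j : (phi i == Some j) = (psi i == Some j) by rewrite -!graphE E.
case phii: (phi i) => [j|]; first by move: (E j); rewrite phii eqxx => /esym/eqP.
case psii: (psi i) => [j|] //.
by move: (E j); rewrite phii psii eqxx.
Qed.

Lemma card_graph (phi : assignment) : #|graph phi @: dom phi| = #|dom phi|.
Proof.
apply: card_in_imset => i i'; rewrite !inE /graph.
case: (phi i) (phi i') => [j|] // [j'|] // _ _.
by move=> /left_right_pair_inj[].
Qed.

Lemma valid_fiber (phi : assignment) i i' j :
  valid phi -> phi i = Some j -> phi i' = Some j -> i = i'.
Proof.
case/andP=> _ /forallP/(_ j)/card_le1_eqP h /eqP pi /eqP pi'.
by apply: h; rewrite inE.
Qed.

Lemma graph_matching (phi : assignment) :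
  valid phi -> is_matching e (graph phi @: dom phi).
Proof.
move=> vphi; have /andP[/forallP vadj _] := vphi.
apply/andP; split; apply/forall_inP => E /imsetP[i idom ->]; move: idom.
  rewrite inE /graph; have := vadj i; case: (phi i) => // j ij _.
  by rewrite adj_pair.
rewrite inE => idom; apply/forall_inP => E' /imsetP[i' idom' ->]; move: idom'.
rewrite inE => idom'; apply/implyP; move: idom idom'; rewrite /graph.
case phii: (phi i) => [j|] // _; case phii': (phi i') => [j'|] // _ neq.
have ii' : i != i'.
  by apply: contraNneq neq => ii'; move: phii phii'; rewrite ii' => -> [->].
have jj' : j != j'.
  apply: contraNneq ii' => jj'; apply/eqP/(valid_fiber vphi phii).
  by rewrite phii' jj'.
rewrite -setI_eq0; apply/eqP/setP => x; rewrite !inE.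
apply/negP => /andP[/orP[]/eqP-> /orP[]]; rewrite ?left_right_neq //.
- by rewrite (inj_eq val_inj) (negbTE ii').
- by rewrite eq_sym left_right_neq.
- by rewrite (inj_eq val_inj) (negbTE jj').
Qed.

Lemma matching_graph (M : {set {set V}}) :
  is_matching e M -> exists2 phi : assignment, valid phi & M = graph phi @: dom phi.
Proof.
case/andP=> /forall_inP Medge /forall_inP Mdisj.
(* Edges of [M] sharing a vertex coincide: on the left this makes the [pick] below unambiguous, on
   the right it bounds the fibres. *)
have Meq E E' x : E \in M -> E' \in M -> x \in E -> x \in E' -> E = E'.
  move=> EM EM' xE xE'; apply/eqP; apply: contraT => neq.
  have /forall_inP/(_ _ EM')/implyP/(_ neq) := Mdisj _ EM.
  by move=> /disjointFr/(_ xE); rewrite xE'.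
pose phi : assignment := [ffun i => [pick j | [set val i; val j] \in M]].
have phiM i j : phi i = Some j -> [set val i; val j] \in M.
  by rewrite ffunE; case: pickP => // j' jM [<-].
have Mphi i j : [set val i; val j] \in M -> phi i = Some j.
  move=> ijM; rewrite ffunE; case: pickP => [j' ij'M|/(_ j)]; last by rewrite ijM.
  by have /left_right_pair_inj[_ ->] := Meq _ _ _ ij'M ijM (set21 _ _) (set21 _ _).
exists phi.
  apply/andP; split; apply/forallP.
    move=> i; case phii: (phi i) => [j|] //.
    by rewrite -adj_pair; apply/Medge/phiM.
  move=> j; apply/card_le1_eqP => i i'; rewrite !inE => /eqP/phiM iM /eqP/phiM iM'.
  by have /left_right_pair_inj[] := Meq _ _ _ iM iM' (set22 _ _) (set22 _ _).
apply/setP => E; apply/idP/imsetP => [EM|[i idom ->]]; last first.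
  by move: idom; rewrite inE /graph; case phii: (phi i) => [j|] // _; apply: phiM.
have [i [j DE]] := is_edge_pair (Medge _ EM); rewrite DE in EM.
by exists i; rewrite ?inE /graph (Mphi _ _ EM).
Qed.

Lemma sum_fiber_card (phi : assignment) : (\sum_j fiber_card phi j)%N = #|dom phi|.
Proof.
rewrite -sum1_card [RHS]big_mkcond.
under eq_bigr => j _ do rewrite /fiber_card -sum1_card big_mkcond.
rewrite exchange_big; apply: eq_bigr => i _; rewrite inE.
under eq_bigr => j _ do rewrite inE.
rewrite -big_mkcond; case: (phi i) => [j|]; last by rewrite big1.
by rewrite (big_pred1 j) // => k; rewrite /= (inj_eq (@Some_inj _)) eq_sym.
Qed.

(** Each unmatched vertex gives one factor [q], the left ones through the weights and the right ones
    through [elim_op]. A non-edge or a fibre of size at least 2 makes the term 0. *)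
Lemma assignment_term (S : comNzRingType) (q t : S) (n : nat) (phi : assignment) :
  #|left_vertex| = n -> #|right_vertex| = n ->
  (\prod_i edge_weight adj q t i (phi i)) *
    \prod_j elim_op q (fiber_card phi j) =
  if valid phi then t ^+ #|dom phi| * q ^+ (2 * (n - #|dom phi|)) else 0.
Proof.
move=> cL cJ; case: ifP => [vphi|/negbT]; last first.
  rewrite negb_and => /orP[] /forallPn /=.
    case=> i; case phii: (phi i) => [j|] // ij.
    by rewrite (bigD1 i) //= phii /= (negbTE ij) mulr0n !mul0r.
  case=> j; rewrite -ltnNge => lt.
  rewrite [X in _ * X](bigD1 j) //= /elim_op.
  by case: (fiber_card phi j) lt => [|[|m]] // _; rewrite mul0r mulr0.
have /andP[/forallP vadj /forallP vfib] := vphi.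
have -> : \prod_i edge_weight adj q t i (phi i) =
    t ^+ #|dom phi| * q ^+ (n - #|dom phi|).
  rewrite (bigID (mem (dom phi))) /=; congr (_ * _).
    rewrite -prodr_const; apply: eq_bigr => i; rewrite inE.
    by have := vadj i; case: (phi i) => // j /= -> _; rewrite mulr1n.
  rewrite -cL -(cardsC (dom phi)) addKn -prodr_const.
  by apply: eq_big => i; rewrite ?in_setC // !inE; case: (phi i).
have -> : \prod_j elim_op q (fiber_card phi j) = q ^+ (n - #|dom phi|).
  have D j : fiber_card phi j = (fiber_card phi j != 0%N) :> nat.
    by have := vfib j; case: fiber_card => [|[]].
  pose B := [set j | fiber_card phi j != 0%N].
  have cB : #|B| = #|dom phi|.
    rewrite -sum_fiber_card -sum1_card [LHS]big_mkcond; apply: eq_bigr => j _.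
    by rewrite inE [RHS]D; case: (_ != _).
  rewrite -cB -cJ -(cardsC B) addKn -prodr_const [RHS]big_mkcond; apply: eq_bigr => j _.
  by rewrite !inE D /elim_op; case: (fiber_card phi j) => [|m].
by rewrite -mulrA -exprD mul2n addnn.
Qed.

(** The surviving assignments correspond bijectively to matchings, which are then grouped by
    size. *)
Lemma assignment_sum_matchings (S : comNzRingType) (q t : S) (n : nat) :
  #|left_vertex| = n -> #|right_vertex| = n ->
  assignment_sum adj q t (fun=> elim_op q) =
  \sum_(0 <= k < n.+1) (num_matchings e k)%:R * t ^+ k * q ^+ (2 * (n - k)).
Proof.
move=> cL cJ; pose g k : S := t ^+ k * q ^+ (2 * (n - k)).
have -> : assignment_sum adj q t (fun=> elim_op q) =
    \sum_(phi : assignment | valid phi) g #|graph phi @: dom phi|.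
  rewrite big_mkcond; apply: eq_bigr => phi _.
  by rewrite (assignment_term _ _ _ cL cJ) card_graph.
have -> : \sum_(phi : assignment | valid phi) g #|graph phi @: dom phi| =
    \sum_(M | is_matching e M) g #|M|.
  rewrite -(big_imset (fun M : {set {set V}} => g #|M|)) /=; last first.
    by move=> phi psi _ _; apply: graph_inj.
  apply: eq_bigl => M; apply/imsetP/idP => [[phi vphi ->]|].
    exact: graph_matching.
  by move=> /matching_graph[phi vphi ->]; exists phi.
rewrite big_mkord.
transitivity (\sum_(k < n.+1) \sum_(M | is_matching e M && (#|M| == k)) g k).
  rewrite (exchange_big_dep (is_matching e)) /=; last by move=> k M _ /andP[].
  apply: eq_bigr => M /[dup] mM /matching_graph[phi _ DM].
  have leM : (#|M| < n.+1)%N by rewrite ltnS DM card_graph -cL max_card.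
  rewrite (big_pred1 (Ordinal leM)) // => k.
  by rewrite mM /= eq_sym.
apply: eq_bigr => k _; rewrite sumr_const /g /num_matchings cardsE.
by rewrite -mulrA mulr_natl.
Qed.

End MatchingAssignment.

(** * Balanced colour classes and the inequality over the reals *)

Lemma card_adj_left (V : finType) (e : rel V) (col : V -> bool) (d : nat) :
  (forall x y, e x y -> col x != col y) -> regular e d ->
  forall i : left_vertex col, #|[set j | adj e i j]| = d.
Proof.
move=> e_col reg i; rewrite -(reg (val i)) -(card_imset _ val_inj).
apply: eq_card => y; rewrite inE; apply/imsetP/idP => [[j + ->]|iy].
  by rewrite inE.
have cy : ~~ col y by have := e_col _ _ iy; rewrite (valP i); case: (col y).
by exists (Sub y cy); rewrite ?inE.
Qed.

Lemma card_adj_right (V : finType) (e : rel V) (col : V -> bool) (d : nat) :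
  (forall x y, e x y = e y x) -> (forall x y, e x y -> col x != col y) ->
  regular e d -> forall j : right_vertex col, #|[set i | adj e i j]| = d.
Proof.
move=> e_sym e_col reg j; rewrite -(reg (val j)) -(card_imset _ val_inj).
apply: eq_card => x; rewrite inE e_sym; apply/imsetP/idP => [[i + ->]|xj].
  by rewrite inE.
have cx : col x by have := e_col _ _ xj; rewrite (negbTE (valP j)); case: (col x).
by exists (Sub x cx); rewrite ?inE.
Qed.

(** Double counting of the edges. *)
Lemma card_biregular (L J : finType) (b : L -> J -> bool) (d : nat) : (0 < d)%N ->
  (forall i, #|[set j | b i j]| = d) -> (forall j, #|[set i | b i j]| = d) ->
  #|L| = #|J|.
Proof.
move=> d0 degL degJ; apply/eqP; rewrite -(eqn_pmul2r d0) -!sum_nat_const; apply/eqP.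
transitivity (\sum_i \sum_j b i j)%N.
  apply: eq_bigr => i _; rewrite -(degL i) -sum1_card big_mkcond /=.
  by apply: eq_bigr => j _; rewrite inE; case: (b i j).
rewrite exchange_big; apply: eq_bigr => j _ /=; rewrite -(degJ j) -sum1_card [RHS]big_mkcond /=.
by apply: eq_bigr => i _; rewrite inE; case: (b i j).
Qed.

Lemma matching_sum_ge_real (K : realType) (V : finType) (e : rel V) (d n : nat) (p : K) :
  simple_graph e -> bipartite e -> regular e d -> (0 < d)%N -> #|V| = (2 * n)%N ->
  0 < p < 1 ->
  (1 - p / d%:R) ^+ (n * d) <=
  \sum_(0 <= k < n.+1) (num_matchings e k)%:R
    * ((p / d%:R) * (1 - p / d%:R)) ^+ k * (1 - p) ^+ (2 * (n - k)).
Proof.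
move=> [e_sym _] [col e_col] reg d0 cV hp.
have degL := card_adj_left e_col reg.
have degJ := card_adj_right e_sym e_col reg.
have cLJ := card_biregular d0 degL degJ.
have cL : #|left_vertex col| = n.
  have : (#|left_vertex col| + #|right_vertex col|)%N = #|V|.
    by rewrite !card_sig -(cardC col); congr (_ + _)%N; apply: eq_card.
  by rewrite -cLJ addnn -mul2n cV => /eqP; rewrite eqn_pmul2l // => /eqP.
have cJ : #|right_vertex col| = n by rewrite -cLJ.
rewrite -(assignment_sum_matchings e_sym e_col _ _ cL cJ).
have := capacity_bound setT (fun=> 0) hp d0 degL degJ.
rewrite (eq_assignment_sum _ _ _ (v := fun=> elim_op (1 - p))); last first.
  by move=> j c; rewrite /partial_op inE.
apply: le_trans; rewrite cardsT cL cJ [X in _ + p * X]big1 ?mulr0 ?addr0 //.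
have q0 : 0 < 1 - p / d%:R.
  have /andP[p0 p1] := hp.
  by rewrite subr_gt0 ltr_pdivrMr ?ltr0n // mul1r (lt_le_trans p1) // ler1n.
(* The initial exponent [n p] and the losses [n (d - p)] from all [n] eliminations add up to
   [n d]. *)
have -> (x y : K) : x * (p * y) + x * ((d%:R - p) * y) = x * d%:R * y by move=> *; ring.
by rewrite -natrM expRM_natl lnK // posrE.
Qed.

(** * Passage to arbitrary ordered fields *)

Definition matching_poly (V : finType) (e : rel V) (d n : nat) : {poly rat} :=
  \sum_(0 <= k < n.+1) (num_matchings e k)%:R
    * ((d%:R^-1 *: 'X) * (1 - d%:R^-1 *: 'X)) ^+ k * (1 - 'X) ^+ (2 * (n - k))
  - (1 - d%:R^-1 *: 'X) ^+ (n * d).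

Lemma horner_matching_poly (F : realFieldType) (V : finType) (e : rel V) (d n : nat) (x : F) :
  (map_poly ratr (matching_poly e d n)).[x] =
  \sum_(0 <= k < n.+1) (num_matchings e k)%:R
    * ((x / d%:R) * (1 - x / d%:R)) ^+ k * (1 - x) ^+ (2 * (n - k))
  - (1 - x / d%:R) ^+ (n * d).
Proof.
have DX : map_poly ratr (1 - 'X) = 1 - 'X :> {poly F}.
  by rewrite rmorphB rmorph1 /= map_polyX.
have Dd : map_poly ratr (d%:R^-1 *: 'X) = d%:R^-1 *: 'X :> {poly F}.
  by rewrite map_polyZ map_polyX fmorphV rmorph_nat.
rewrite rmorphB rmorph_sum hornerD hornerN horner_sum; congr (_ - _).
  apply: eq_bigr => k _; rewrite !rmorphM !rmorphXn !rmorphM /= DX rmorphB rmorph1 /= Dd rmorph_nat.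
  rewrite !hornerM !horner_exp !hornerM -[X in X.[x]]polyC_natr.
  by rewrite !hornerE [_^-1 * x]mulrC.
by rewrite rmorphXn rmorphB rmorph1 /= Dd horner_exp !hornerE [_^-1 * x]mulrC.
Qed.

Theorem theorem1p6 (R : realFieldType) (V : finType) (e : rel V) (d n : nat)
  (p : R) :
  simple_graph e -> bipartite e -> regular e d -> (1 <= d)%N ->
  #|V| = (2 * n)%N -> 0 <= p -> p <= 1 ->
  \sum_(0 <= k < n.+1)
     (num_matchings e k)%:R
       * ((p / d%:R) * (1 - p / d%:R)) ^+ k * (1 - p) ^+ (2 * (n - k))
  >= (1 - p / d%:R) ^+ (n * d).
Proof.
move=> simple bip reg d1 cV p0 p1.
rewrite -subr_ge0 -horner_matching_poly.
apply: (@ratr_horner_ge0 (Rdefinitions.R : realType)); last by rewrite p0.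
(* Multiplying by [X (1 - X)] makes the endpoints trivial, so the real inequality is required only
   for [0 < p < 1]. *)
apply: (@horner_ge0_factor _ ('X * (1 - 'X))).
- by rewrite mulf_neq0 ?polyX_eq0 // -opprB oppr_eq0 polyXsubC_eq0.
- by move=> x /andP[x0 x1]; rewrite !hornerE mulr_ge0 // subr_ge0.
move=> x /andP[x0 x1]; rewrite hornerM horner_matching_poly !hornerE.
have [->|nx0] := eqVneq x 0; first by rewrite !mul0r.
have [->|nx1] := eqVneq x 1; first by rewrite subrr mulr0 mul0r.
rewrite mulr_ge0 ?mulr_ge0 ?subr_ge0 //; apply: matching_sum_ge_real => //.
by rewrite !lt_neqAle x0 x1 eq_sym nx0 nx1.
Qed.
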